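(* Let $\alpha\ge\beta>-\frac12$ and $x,y>0$. Then $\mathcal{K}_{\alpha,\beta}(x,y,z)<0$ for all $z$ with $-x-y<z<-|x-y|$, while $\mathcal{K}_{\alpha,\beta}(x,y,z)>0$ for all $z$ with $|x-y|<z<x+y$. In particular, the measure $d\mu_{x,y}^{(\alpha,\beta)}(z)=\mathcal{K}_{\alpha,\beta}(x,y,z)\,A_{\alpha,\beta}(|z|)\,dz$ is not positive.
   Context: $\rho=\alpha+\beta+1$ and $A_{\alpha,\beta}(z)=(\sinh z)^{2\alpha+1}(\cosh z)^{2\beta+1}$ for $z\ge0$. The kernels $\mathcal{K}_{\alpha,\beta}(x,y,z)$ vanish unless $x,y,z\ne0$ and $\bigl||x|-|y|\bigr|<|z|<|x|+|y|$, in which case: • for $\alpha>\beta>-\frac12$, $$\mathcal{K}_{\alpha,\beta}(x,y,z)=M_{\alpha,\beta}\,|\sinh x\sinh y\sinh z|^{-2\alpha}\int_0^\pi g(x,y,z,\chi)_+^{\alpha-\beta-1}\Bigl[1-\sigma_{x,y,z}^\chi+\sigma_{x,z,y}^\chi+\sigma_{z,y,x}^\chi+\frac{\rho}{\beta+\frac12}\coth x\coth y\coth z\,(\sin\chi)^2\Bigr](\sin\chi)^{2\beta}\,d\chi,$$ where $M_{\alpha,\beta}=\frac{\Gamma(\alpha+1)}{\sqrt{\pi}\,\Gamma(\alpha-\beta)\,\Gamma(\beta+\frac12)}$, $g(x,y,z,\chi)=1-\cosh^2x-\cosh^2y-\cosh^2z+2\cosh x\cosh y\cosh z\cos\chi$,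 $g_+^s$ means $g^s$ where $g>0$ and $0$ where $g\le0$, and $\sigma_{a,b,c}^\chi=\frac{\cosh a\cosh b-\cosh c\cos\chi}{\sinh a\sinh b}$ for $ab\neq0$; • for $\alpha=\beta>-\frac12$, with $M_{\alpha,\alpha}=\frac{\Gamma(\alpha+1)}{\sqrt\pi\,\Gamma(\alpha+\frac12)}$, $$\mathcal{K}_{\alpha,\alpha}(x,y,z)=2^{4\alpha+2}M_{\alpha,\alpha}\,e^{x+y-z}\,\frac{\bigl[\sinh(x+y+z)\sinh(-x+y+z)\sinh(x-y+z)\sinh(x+y-z)\bigr]^{\alpha-\frac12}}{|\sinh2x\,\sinh2y\,\sinh2z|^{2\alpha}}\cdot\frac{\sinh(x+y+z)\sinh(-x+y+z)\sinh(x-y+z)}{\sinh2x\,\sinh2y\,\sinh2z}.$$ *)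

(* Defs.v *)
From HB Require Import structures.
From mathcomp Require Import all_boot all_order all_algebra.
From mathcomp Require Import all_classical all_reals all_analysis.

Set Implicit Arguments.
Unset Strict Implicit.
Unset Printing Implicit Defensive.

Import Order.TTheory GRing.Theory Num.Theory.
Import numFieldNormedType.Exports.

Local Open Scope classical_set_scope.
Local Open Scope ring_scope.

Definition sinh (R : realType) (x : R) : R := (expR x - expR (- x)) / 2.

Definition cosh (R : realType) (x : R) : R := (expR x + expR (- x)) / 2.

Definition coth (R : realType) (x : R) : R := cosh x / sinh x.

(* Euler's integral; it only represents the Gamma function for 0 < s. *)
Definition Gamma (R : realType) (s : R) : R :=
  \int[lebesgue_measure]_(t in `]0, +oo[) (t `^ (s - 1) * expR (- t)).

(* Since powR is not 0 on all negative bases, positivity is tested explicitly. *)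
Definition ppow (R : realType) (g s : R) : R := if 0 < g then g `^ s else 0.

Definition rho (R : realType) (alpha beta : R) : R := alpha + beta + 1.

Definition weightA (R : realType) (alpha beta z : R) : R :=
  sinh z `^ (2 * alpha + 1) * cosh z `^ (2 * beta + 1).

Definition constM (R : realType) (alpha beta : R) : R :=
  if alpha == beta then
    Gamma (alpha + 1) / (Num.sqrt pi * Gamma (alpha + 1 / 2))
  else
    Gamma (alpha + 1) /
      (Num.sqrt pi * Gamma (alpha - beta) * Gamma (beta + 1 / 2)).

Definition gfun (R : realType) (x y z chi : R) : R :=
  1 - cosh x ^+ 2 - cosh y ^+ 2 - cosh z ^+ 2
  + 2 * cosh x * cosh y * cosh z * cos chi.

Definition sigma (R : realType) (a b c chi : R) : R :=
  (cosh a * cosh b - cosh c * cos chi) / (sinh a * sinh b).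

Definition kernel_gt (R : realType) (alpha beta x y z : R) : R :=
  constM alpha beta * `|sinh x * sinh y * sinh z| `^ (- (2 * alpha))
  * \int[lebesgue_measure]_(chi in `[0, pi])
      (ppow (gfun x y z chi) (alpha - beta - 1)
       * (1 - sigma x y z chi + sigma x z y chi + sigma z y x chi
          + rho alpha beta / (beta + 1 / 2)
            * (coth x * coth y * coth z) * sin chi ^+ 2)
       * sin chi `^ (2 * beta)).

Definition kernel_eq (R : realType) (alpha x y z : R) : R :=
  2 `^ (4 * alpha + 2) * constM alpha alpha * expR (x + y - z)
  * ((sinh (x + y + z) * sinh (- x + y + z) * sinh (x - y + z)
        * sinh (x + y - z)) `^ (alpha - 1 / 2)
     / `|sinh (2 * x) * sinh (2 * y) * sinh (2 * z)| `^ (2 * alpha))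
  * (sinh (x + y + z) * sinh (- x + y + z) * sinh (x - y + z)
     / (sinh (2 * x) * sinh (2 * y) * sinh (2 * z))).

(* Only meaningful for - 1 / 2 < beta <= alpha. *)
Definition kernelK (R : realType) (alpha beta x y z : R) : R :=
  if [&& x != 0, y != 0, z != 0,
         `| `|x| - `|y| | < `|z| & `|z| < `|x| + `|y| ] then
    if alpha == beta then kernel_eq alpha x y z
    else kernel_gt alpha beta x y z
  else 0.

(* The signed measure with density z |-> K(x, y, z) A(|z|) with respect to
   the Lebesgue measure. *)
Definition muK (R : realType) (alpha beta x y : R) (E : set R) : \bar R :=
  (\int[lebesgue_measure]_(z in E)
    (kernelK alpha beta x y z * weightA alpha beta `|z|)%:E)%E.

(* Main.v *)
Require Import Defs.
From mathcomp Require Import all_boot all_order all_algebra.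
From mathcomp Require Import all_classical all_reals all_analysis.
From mathcomp Require Import measurable_realfun ring lra.

Import Order.TTheory GRing.Theory Num.Theory.
Import numFieldNormedType.Exports.

(** The bracket in the kernel has the sign of z pointwise.  Multiplied by
    sinh x sinh y sinh z it is a concave quadratic polynomial in C = cos chi, to
    be shown positive for gfun_root <= C <= 1, that is where g >= 0; so only the
    end points matter.  At C = 1 it equals
    4 sinh((x+y+z)/2) sinh((x+z-y)/2) sinh((y+z-x)/2) cosh((x+y-z)/2), and at
    the root of g the numbers sigma become those at C = 1 for the sides 2x, 2y,
    2z, plus a nonnegative term.  The chi-integral converges, because
    g^a sin^b is dominated by a combination of g^a sin and sin^b cos, whose
    primitives are bounded.  Non-positivity of the measure follows by
    integrating over the interval of negative z. *)

Local Open Scope classical_set_scope.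
Local Open Scope charge_scope.
Local Open Scope ring_scope.

(** * Hyperbolic identities and positivity at cos chi = 1 *)

Section hyperbolic.
Context {R : realType}.
Implicit Types x y z : R.

Lemma sinh_gt0 x : (0 < sinh x) = (0 < x).
Proof.
rewrite /sinh pmulr_lgt0 ?invr_gt0 ?ltr0n// subr_gt0 ltr_expR.
by rewrite -subr_gt0 opprK -mulr2n pmulrn_lgt0.
Qed.

Lemma sinhN x : sinh (- x) = - sinh x.
Proof. by rewrite /sinh opprK -mulNr opprB. Qed.

Lemma sinh_lt0 x : (sinh x < 0) = (x < 0).
Proof. by rewrite -oppr_gt0 -sinhN sinh_gt0 oppr_gt0. Qed.

Lemma sinh_eq0 x : (sinh x == 0) = (x == 0).
Proof.
have := sinh_gt0 x; have := sinh_lt0 x.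
by case: (ltgtP x 0) => //; case: (ltgtP (sinh x) 0).
Qed.

Lemma cosh_gt0 x : 0 < cosh x.
Proof. by rewrite /cosh divr_gt0// addr_gt0// expR_gt0. Qed.

Lemma sqr_cosh x : cosh x ^+ 2 = 1 + sinh x ^+ 2.
Proof.
rewrite /cosh /sinh expRN; have := expR_eq0 x; move: (expR x) => e /negbT e0.
by field.
Qed.

Lemma cosh2 x : cosh (2 * x) = 2 * cosh x ^+ 2 - 1.
Proof.
rewrite /cosh -mulrN !expRM_natl expRN; have := expR_eq0 x.
by move: (expR x) => e /negbT e0; field.
Qed.

Lemma sinh2 x : sinh (2 * x) = 2 * sinh x * cosh x.
Proof.
rewrite /cosh /sinh -mulrN !expRM_natl expRN; have := expR_eq0 x.
by move: (expR x) => e /negbT e0; field.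
Qed.

(* For a hyperbolic triangle with sides x, y, z and opposite angles a, b, c this
   is sinh x sinh y sinh z (1 - cos c + cos b + cos a). *)
Definition triangle_numer x y z :=
  sinh x * sinh y * sinh z - sinh z * (cosh x * cosh y - cosh z)
  + sinh y * (cosh x * cosh z - cosh y) + sinh x * (cosh z * cosh y - cosh x).

Lemma triangle_numerE x y z : triangle_numer x y z =
  4 * (sinh ((x + y + z) / 2) * (sinh ((x + z - y) / 2)
     * sinh ((y + z - x) / 2)) * cosh ((x + y - z) / 2)).
Proof.
(* Half arguments occur on the right, so everything is expressed in exp(x/2), exp(y/2), exp(z/2);
   the claim becomes an identity of rational functions. *)
have h (t : R) : expR t = expR (t / 2) ^+ 2.
  by rewrite -expRM_natl mulrC divfK// pnatr_eq0.
rewrite /triangle_numer /cosh /sinh !expRN !(mulrDl _ _ 2^-1) !mulNr !expRD !expRN.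
rewrite (h x) (h y) (h z).
have := expR_eq0 (x/2); have := expR_eq0 (y/2); have := expR_eq0 (z/2).
move: (expR (x/2)) (expR (y/2)) (expR (z/2)) => a b c /negbT c0 /negbT b0 /negbT a0.
by field; rewrite a0 b0 c0.
Qed.

(** Since |x - y| < |z|, the factors sinh((x+z-y)/2) and sinh((y+z-x)/2) both have the sign of z, so
    their product is positive for either sign of z. *)
Lemma triangle_numer_gt0 x y z : 0 < x -> 0 < y ->
  `|x - y| < `|z| -> `|z| < x + y -> 0 < triangle_numer x y z.
Proof.
move=> x0 y0; rewrite ltr_norml ltr_normr => + /ltr_normlP[z1 z2].
move=> xyz.
rewrite triangle_numerE mulr_gt0// mulr_gt0 ?cosh_gt0// mulr_gt0//.
  by rewrite sinh_gt0; lra.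
have [z0|z0] := ltP 0 z.
  by rewrite mulr_gt0// sinh_gt0; move: xyz; rewrite gtr0_norm//; lra.
by rewrite nmulr_lgt0 sinh_lt0; move: xyz; rewrite ler0_norm//; lra.
Qed.
End hyperbolic.

(** * The bracket as a quadratic polynomial in cos chi *)

Section bracket.
Context {R : realType}.
Implicit Types K x y z C chi : R.

(** Here [C] stands for cos chi and [K] for rho / (beta + 1/2). *)
Definition bracket_numer K x y z C :=
  sinh x * sinh y * sinh z - sinh z * (cosh x * cosh y - cosh z * C)
  + sinh y * (cosh x * cosh z - cosh y * C)
  + sinh x * (cosh z * cosh y - cosh x * C)
  + K * (cosh x * cosh y * cosh z) * (1 - C ^+ 2).

Lemma bracketE K x y z chi : x != 0 -> y != 0 -> z != 0 ->
  1 - sigma x y z chi + sigma x z y chi + sigma z y x chi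
    + K * (coth x * coth y * coth z) * sin chi ^+ 2 =
  bracket_numer K x y z (cos chi) / (sinh x * sinh y * sinh z).
Proof.
rewrite -(sinh_eq0 x) -(sinh_eq0 y) -(sinh_eq0 z) => x0 y0 z0.
rewrite /bracket_numer /sigma /coth sin2cos2; field.
by rewrite x0 y0 z0.
Qed.

(* The zero of [gfun x y z] as a function of [cos chi]. *)
Definition gfun_root x y z :=
  (cosh x ^+ 2 + cosh y ^+ 2 + cosh z ^+ 2 - 1)
  / (2 * cosh x * cosh y * cosh z).

Lemma cosh_neq0 x : cosh x != 0.
Proof. by rewrite gt_eqF// cosh_gt0. Qed.

(** Being affine in cos chi with positive slope, g is positive exactly where cos chi exceeds
    [gfun_root]. *)
Lemma gfunE x y z chi : gfun x y z chi =
  2 * cosh x * cosh y * cosh z * (cos chi - gfun_root x y z).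
Proof.
by rewrite /gfun /gfun_root; field; rewrite !cosh_neq0.
Qed.

Lemma gfun_root_gt0 x y z : 0 < gfun_root x y z.
Proof.
rewrite /gfun_root divr_gt0// ?(cosh_gt0, mulr_gt0)// !sqr_cosh.
have := sqr_ge0 (sinh x); have := sqr_ge0 (sinh y); have := sqr_ge0 (sinh z).
lra.
Qed.

Lemma cosh_abs x : cosh `|x| = cosh x.
Proof. by rewrite /cosh; case: (ger0P x) => //; rewrite opprK addrC. Qed.

(* At [chi = 0] the function [gfun] is a product of four hyperbolic sines. *)
Lemma gfun_root_lt1 x y z : 0 < x -> 0 < y ->
  `|x - y| < `|z| -> `|z| < x + y -> gfun_root x y z < 1.
Proof.
(* Only cosh z occurs, so z may be replaced by |z|, and then all four sines are positive. *)
move=> x0 y0; rewrite /gfun_root -(cosh_abs z).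
move: `|z| (normr_ge0 z) => {}z z0 /ltr_normlP[z1 z2] z3.
rewrite ltr_pdivrMr ?(cosh_gt0, mulr_gt0)// mul1r -subr_gt0.
suff -> : 2 * cosh x * cosh y * cosh z -
    (cosh x ^+ 2 + cosh y ^+ 2 + cosh z ^+ 2 - 1) =
  4 * (sinh ((x + y + z) / 2) * sinh ((x + z - y) / 2)
     * (sinh ((y + z - x) / 2) * sinh ((x + y - z) / 2))).
  by apply: mulr_gt0 => //; apply: mulr_gt0; apply: mulr_gt0; rewrite sinh_gt0; lra.
have h (t : R) : expR t = expR (t / 2) ^+ 2.
  by rewrite -expRM_natl mulrC divfK// pnatr_eq0.
rewrite /cosh /sinh !expRN !(mulrDl _ _ 2^-1) !mulNr !expRD !expRN.
rewrite (h x) (h y) (h z).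
have := expR_eq0 (x/2); have := expR_eq0 (y/2); have := expR_eq0 (z/2).
move: (expR (x/2)) (expR (y/2)) (expR (z/2)) => a b c /negbT c0 /negbT b0 /negbT a0.
by field; rewrite a0 b0 c0.
Qed.

(* At the zero of [gfun], the law of cosines for the sides [x], [y], [z]
   becomes that for a hyperbolic triangle with sides [2x], [2y], [2z]. *)
Lemma bracket_numer_root K x y z :
  bracket_numer K x y z (gfun_root x y z) =
  triangle_numer (2 * x) (2 * y) (2 * z) / (8 * (cosh x * cosh y * cosh z))
  + K * (cosh x * cosh y * cosh z) * (1 - gfun_root x y z ^+ 2).
Proof.
rewrite /bracket_numer /triangle_numer; congr (_ + _).
rewrite /gfun_root !sinh2 !cosh2.
by field; rewrite !cosh_neq0.
Qed.

(* [bracket_numer] is concave in [C], so it suffices to look at [C = 1] and at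
   the zero of [gfun]. *)
Lemma bracket_numer_gt0 K x y z C : 0 <= K -> 0 < x -> 0 < y ->
  `|x - y| < `|z| -> `|z| < x + y -> gfun_root x y z <= C -> C <= 1 ->
  0 < bracket_numer K x y z C.
Proof.
move=> K0 x0 y0 xyz zxy rC.
have r0 := gfun_root_gt0 x y z; have r1 := gfun_root_lt1 _ _ _ x0 y0 xyz zxy.
have T1 := triangle_numer_gt0 _ _ _ x0 y0 xyz zxy.
have T2 : 0 < triangle_numer (2 * x) (2 * y) (2 * z).
  apply: triangle_numer_gt0; rewrite ?mulr_gt0//;
    by rewrite -?mulrBr -?mulrDr !normrM ?(@gtr0_norm _ 2)// ltr_pM2l.
have D0 : 0 < cosh x * cosh y * cosh z by rewrite !(cosh_gt0, mulr_gt0).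
have Br : 0 < bracket_numer K x y z (gfun_root x y z).
  rewrite bracket_numer_root; apply: ltr_wpDr.
    by rewrite !mulr_ge0// ?(ltW D0) ?(ltW (cosh_gt0 _))// subr_ge0 expr_le1// ltW.
  by rewrite divr_gt0// mulr_gt0.
have E1 : bracket_numer K x y z 1 = triangle_numer x y z.
  by rewrite /bracket_numer /triangle_numer expr1n; ring.
rewrite -E1 in T1; move: r0 r1 Br rC; set r := gfun_root x y z => r0 r1 Br rC C1.
have KD : 0 <= K * (cosh x * cosh y * cosh z) by rewrite mulr_ge0// ltW.
rewrite -(pmulr_rgt0 _ (_ : 0 < 1 - r)) ?subr_gt0//.
(* Linear interpolation between the end points r and 1; the last term is the excess of the concave
   quadratic over its chord. *)
have -> : (1 - r) * bracket_numer K x y z C =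
   (C - r) * bracket_numer K x y z 1 + (1 - C) * bracket_numer K x y z r
   + K * (cosh x * cosh y * cosh z) * ((1 - C) * (1 - r) * (C - r)).
  by rewrite /bracket_numer; ring.
apply: ltr_wpDr; first by rewrite mulr_ge0// !mulr_ge0// subr_ge0// ltW.
move: rC; rewrite le_eqVlt => /predU1P[<-|rC].
  by rewrite subrr mul0r add0r mulr_gt0// subr_gt0.
by rewrite ltr_wpDr// ?mulr_gt0 ?mulr_ge0 ?subr_gt0 ?subr_ge0// ltW.
Qed.

End bracket.

(** * Integrability from a bounded primitive, and strict positivity of integrals *)

Section integrability.
Context {R : realType}.
Local Notation mu := (@lebesgue_measure R).

(** On each compact interval the integral is F(b n) - F(a n), at most 2M, and monotone convergence
    carries the bound to D. Exhausting sequences let one statement serve bounded intervals and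
    half-lines. *)
Lemma integrable_bounded_primitive (f F : R -> R) (D : set R) (a b : R^nat)
    (M : R) :
  (forall n, a n < b n) -> nonincreasing_seq a -> nondecreasing_seq b ->
  D = \bigcup_n `[a n, b n]%classic ->
  (forall t, D t -> 0 <= f t) -> (forall t, D t -> {for t, continuous f}) ->
  (forall t, D t -> is_derive t 1 F (f t)) -> (forall t, D t -> `|F t| <= M) ->
  mu.-integrable D (EFin \o f).
Proof.
move=> ab nia ndb DE f0 cf dF FM.
have subD n : `[a n, b n]%classic `<=` D by rewrite DE => t; exists n.
have mI n : measurable (`[a n, b n]%classic : set R) by [].
have cI n : {within `[a n, b n], continuous f}.
  by apply: continuous_in_subspaceT => t /set_mem/subD; exact: cf.
have mfI n : measurable_fun (`[a n, b n]%classic : set R) f.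
  exact: subspace_continuous_measurable_fun.
have mf : measurable_fun D f by rewrite DE; apply/measurable_fun_bigcup.
apply/integrableP; split; first exact/measurable_EFinP.
have -> : (\int[mu]_(x in D) `|(EFin \o f) x| = \int[mu]_(x in D) (f x)%:E)%E.
  by apply: eq_integral => t /set_mem/f0 ft /=; rewrite ger0_norm.
have cF t : D t -> {for t, continuous F}.
  move=> /dF[dFt _]; apply: differentiable_continuous.
  exact/derivable1_diffP.
have FTC n : (\int[mu]_(x in `[a n, b n]) (f x)%:E = (F (b n))%:E - (F (a n))%:E)%E.
  apply: continuous_FTC2 => //.
  - split.
    + move=> t tab; have /dF[] // : D t.
      by apply: (subD n); exact: subset_itv_oo_cc.
    + apply: cvg_at_right_filter; apply: cF; apply: (subD n) => /=.
      by rewrite in_itv/= lexx ltW.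
    + apply: cvg_at_left_filter; apply: cF; apply: (subD n) => /=.
      by rewrite in_itv/= lexx ltW.
  - move=> t tab; have /dF[_ <-] : D t.
      by apply: (subD n); exact: subset_itv_oo_cc.
    by rewrite derive1E.
have ndI : nondecreasing_seq (fun n => `[a n, b n]%classic : set R).
  move=> m n mn; apply/subsetPset => t /=; rewrite !in_itv/= => /andP[at_ tb].
  by rewrite (le_trans (nia _ _ mn))// (le_trans tb)// ndb.
have cvgI : (\int[mu]_(x in `[a i, b i]) (f x)%:E @[i --> \oo]
    --> \int[mu]_(x in D) (f x)%:E)%E.
  rewrite DE; apply: ge0_nondecreasing_set_cvg_integral => //.
  - by move=> n; exact: (iffRL (measurable_EFinP _ _) (mfI n)).
  - by move=> n t nt; rewrite lee_fin; apply: f0; exact: (subD n).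
apply: (@le_lt_trans _ _ (M + M)%:E); last exact: ltry.
rewrite -(cvg_lim _ cvgI)//; apply: lime_le; first by apply/cvg_ex; eexists; exact: cvgI.
apply: nearW => n; rewrite FTC -EFinB lee_fin.
have Ha : D (a n) by apply: (subD n) => /=; rewrite in_itv/= lexx ltW.
have Hb : D (b n) by apply: (subD n) => /=; rewrite in_itv/= lexx ltW.
apply: le_trans (ler_norm _) _; apply: le_trans (ler_normB _ _) _.
by rewrite lerD// FM.
Qed.

(** A zero integral would force f = 0 almost everywhere, contradicting f > 0 on the non-null set
    E. *)
Lemma integral_gt0 d (T : measurableType d) (nu : {measure set T -> \bar R})
    (f : T -> \bar R) (D E : set T) :
  measurable D -> measurable E -> E `<=` D -> measurable_fun D f ->
  (forall t, D t -> (0 <= f t)%E) -> (forall t, E t -> (0 < f t)%E) ->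
  (0 < nu E)%E -> (0 < \int[nu]_(t in D) f t)%E.
Proof.
move=> mD mE ED mf f0 fE muE.
rewrite lt_neqAle integral_ge0// andbT; apply/eqP => /esym I0.
have : (\int[nu]_(t in D) `|f t| = 0)%E.
  by rewrite -I0; apply: eq_integral => t /set_mem/f0; exact: gee0_abs.
move=> /(proj1 (ae_eq_integral_abs _ mD mf))[N [mN N0 subN]].
suff : (nu E <= 0)%E by rewrite leNgt muE.
rewrite -N0; apply: le_measure; rewrite ?inE//.
apply: subset_trans subN => t Et /= /(_ (ED t Et)) ft0.
by have := fE t Et; rewrite ft0 ltxx.
Qed.

(** The real-valued integral sends an infinite value to 0, so strict positivity rests on
    integrability. *)
Lemma Rintegral_gt0 d (T : measurableType d) (nu : {measure set T -> \bar R})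
    (f : T -> R) (D E : set T) : measurable D -> measurable E ->
  E `<=` D -> nu.-integrable D (EFin \o f) -> (forall t, D t -> 0 <= f t) ->
  (forall t, E t -> 0 < f t) -> (0 < nu E)%E ->
  0 < \int[nu]_(t in D) f t.
Proof.
move=> mD mE ED fi f0 fE muE; apply: fine_gt0; apply/andP; split; last first.
  by rewrite ltey_eq integrable_fin_num.
apply: (@integral_gt0 _ _ _ _ D E) => //; exact: measurable_int fi.
Qed.

End integrability.

(** * Convergence and positivity of Euler's integral *)

Section gamma.
Context {R : realType}.
Local Notation mu := (@lebesgue_measure R).

Lemma continuous_powR_comp (g : R -> R) (p t : R) : {for t, continuous g} ->
  0 < g t -> {for t, continuous (fun x => g x `^ p)}.
Proof.
move=> cg g0; apply: (@continuous_comp _ _ _ g (@powR R ^~ p)) => //.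
apply: differentiable_continuous; apply/derivable1_diffP.
by apply: derivable_powR; rewrite in_itv/= g0.
Qed.

(** Raise 1 + t <= (s+1)(1 + t/(s+1)) <= (s+1) exp(t/(s+1)) to the power s+1. *)
Lemma powR_le_expR (s t : R) : 0 < s -> 0 <= t ->
  (1 + t) `^ (s + 1) <= (s + 1) `^ (s + 1) * expR t.
Proof.
move=> s0 t0; have s10 : 0 < s + 1 by rewrite addr_gt0.
have -> : expR t = expR (t / (s + 1)) `^ (s + 1) by rewrite -expRM divfK ?gt_eqF.
rewrite -powRM ?expR_ge0 ?(ltW s10)//; apply: ge0_ler_powR.
- exact: ltW.
- by rewrite nnegrE addr_ge0.
- by rewrite nnegrE mulr_ge0 ?expR_ge0// ltW.
- have := expR_ge1Dx (t / (s + 1)); rewrite -(ler_pM2l s10).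
  by rewrite mulrDr mulr1 mulrCA divff ?gt_eqF// mulr1; lra.
Qed.

(* The integrand is dominated by a multiple of the derivative of
   [(t / (1 + t)) ^ s / s], which is bounded. *)
Lemma integrable_Gamma (s : R) : 0 < s ->
  mu.-integrable `]0, +oo[ (EFin \o (fun t : R => t `^ (s - 1) * expR (- t))).
Proof.
move=> s0.
pose u (t : R) := t / (1 + t).
pose h (t : R) := u t `^ (s - 1) * (1 + t) ^- 2.
pose F (t : R) := s^-1 * u t `^ s.
have t1 (t : R) : 0 < t -> 0 < 1 + t by move=> ?; rewrite addr_gt0.
have u0 (t : R) : 0 < t -> 0 < u t by move=> t0; rewrite divr_gt0// t1.
have du (t : R) : 0 < t -> is_derive t 1 u ((1 + t) ^- 2).
  move=> t0; have H : is_derive t 1 (fun x : R => 1 + x) (0 + 1).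
    exact: is_deriveD.
  have := is_deriveM (is_derive_id t (1 : R))
    (is_deriveV (lt0r_neq0 (t1 _ t0)) H).
  move=> /is_derive_eq; apply.
  rewrite /GRing.scale/= add0r.
  by field; rewrite gt_eqF// t1.
have dF (t : R) : 0 < t -> is_derive t 1 F (h t).
  move=> t0.
  have H := @is_derive1_comp _ _ _ t _ _ (is_derive1_powR s (u0 _ t0)) (du _ t0).
  have := @is_deriveZ _ _ _ _ s^-1 t 1 _ H.
  move=> /is_derive_eq; apply.
  by rewrite /GRing.scale/= /h !mulrA mulVf ?mul1r// gt_eqF.
have ih : mu.-integrable `]0, +oo[ (EFin \o h).
  (* The offset 2 gives 1/(n+2) < 1 < n+2 already at n = 0; the bound 1/s holds because 0 < u <
     1. *)
  apply: (@integrable_bounded_primitive _ h F _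
    (fun n => n.+2%:R^-1) (fun n => n.+2%:R) (s^-1)).
  - by move=> n; apply: (@lt_trans _ _ 1); rewrite ?invf_lt1 ?ltr1n.
  - by move=> m n mn; rewrite lef_pV2 ?posrE// ler_nat.
  - by move=> m n mn; rewrite ler_nat.
  - apply/seteqP; split => t /=.
      rewrite in_itv/= andbT => t0.
      (* Then n + 1 exceeds both t and 1/t. *)
      pose n := Num.truncn (t + t^-1).
      exists n => //=; rewrite in_itv/=.
      have tV0 : 0 < t^-1 by rewrite invr_gt0.
      have : t + t^-1 < n.+1%:R by apply: truncnS_gt.
      rewrite -[n.+2]addn1 natrD => tn; apply/andP; split; last lra.
      rewrite -[leRHS]invrK lef_pV2 ?posrE ?invr_gt0//; lra.
    move=> [n _] /=; rewrite !in_itv/= andbT => /andP[+ _].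
    by apply: lt_le_trans; rewrite invr_gt0.
  - move=> t; rewrite /= in_itv/= andbT => t0.
    by rewrite mulr_ge0 ?powR_ge0// invr_ge0 sqr_ge0.
  - move=> t; rewrite /= in_itv/= andbT => t0.
    apply: continuousM.
      apply: continuous_powR_comp; last exact: u0.
      apply: differentiable_continuous; apply/derivable1_diffP.
      by have [] := du _ t0.
    apply: continuousV; first by rewrite expf_neq0// gt_eqF// t1.
    apply: (@continuous_comp _ _ _ (fun x : R => 1 + x) (fun y => y ^+ 2)).
      by apply: continuousD; [exact: cst_continuous|exact: cvg_id].
    exact: exprn_continuous.
  - by move=> t; rewrite /= in_itv/= andbT => t0; exact: dF.
  - move=> t; rewrite /= in_itv/= andbT => t0.
    rewrite /F ger0_norm ?mulr_ge0 ?powR_ge0 ?invr_ge0 ?(ltW s0)//.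
    rewrite ler_piMr ?invr_ge0 ?(ltW s0)//.
    apply: (@le_trans _ _ (1 `^ s)); last by rewrite powR1.
    apply: ge0_ler_powR; rewrite ?nnegrE ?(ltW s0) ?(ltW (u0 _ t0))//.
    by rewrite /u ler_pdivrMr ?t1//; lra.
apply: le_integrable (integrableZl _ (((s + 1) `^ (s + 1)) : R) ih) => //.
- apply/measurable_EFinP; apply: measurable_funM.
    by apply: measurable_funTS; exact: measurable_powR.
  apply: measurable_funTS; apply: measurableT_comp => //.
- move=> t; rewrite /= in_itv/= andbT => t0.
  rewrite lee_fin !ger0_norm ?mulr_ge0 ?powR_ge0 ?expR_ge0 ?invr_ge0 ?sqr_ge0//.
  (* Once the common factor u^(s-1) is cancelled, the claim is [powR_le_expR]. *)
  have -> : t `^ (s - 1) = u t `^ (s - 1) * (1 + t) `^ (s - 1).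
    by rewrite -powRM ?(ltW (u0 _ t0)) ?(ltW (t1 _ t0))// divfK// gt_eqF// t1.
  rewrite -mulrA [leRHS]mulrCA ler_wpM2l ?powR_ge0//.
  rewrite ler_pdivlMr ?exprn_gt0 ?t1// expRN mulrAC ler_pdivrMr ?expR_gt0//.
  apply: le_trans (powR_le_expR _ _ s0 (ltW t0)).
  have -> : (1 + t) `^ (s + 1) = (1 + t) `^ (s - 1) * (1 + t) ^+ 2.
    rewrite -powR_mulrn ?(ltW (t1 _ t0))// -powRD; first by congr (_ `^ _); ring.
    by rewrite (negbT (gt_eqF (t1 _ t0))) implybT.
  by [].
Qed.

Lemma Gamma_gt0 (s : R) : 0 < s -> 0 < Gamma s.
Proof.
move=> s0.
have mu0 : (0 < mu (`]0%R, +oo[%classic : set R))%E.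
  by rewrite lebesgue_measure_itv/= ltry addye.

rewrite /Gamma; apply: (@Rintegral_gt0 R _ _ mu _ _ `]0, +oo[%classic) => //.
- exact: integrable_Gamma.
- by move=> t _; rewrite mulr_ge0 ?powR_ge0 ?expR_ge0.
- move=> t /=; rewrite in_itv/= andbT => t0.
  by rewrite mulr_gt0 ?powR_gt0 ?expR_gt0.
Qed.
End gamma.
(** The power is monotone, increasing or decreasing with the sign of p; the sum of the end values
    covers both cases. *)
Lemma powR_le_bounds (R : realType) (m M t p : R) : 0 < m -> m <= t -> t <= M ->
  t `^ p <= m `^ p + M `^ p.
Proof.
move=> m0 mt tM; have t0 := lt_le_trans m0 mt; have M0 := lt_le_trans t0 tM.
have [p0|p0] := leP 0 p.
  by rewrite ler_wpDl ?powR_ge0// ge0_ler_powR ?nnegrE// ltW.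
rewrite ler_wpDr ?powR_ge0// -(opprK p) !(powRN _ (- p)).
rewrite lef_pV2 ?posrE ?powR_gt0// ge0_ler_powR ?nnegrE ?oppr_ge0// ltW//.
Qed.

(** * Convergence of the chi-integral at both ends of the support *)

Section truncated_cosine.
Context {R : realType}.
Local Notation mu := (@lebesgue_measure R).
Variables (k c a b : R).
Hypotheses (k0 : 0 < k) (c0 : 0 < c) (c1 : c < 1) (a1 : - 1 < a) (b1 : - 1 < b).

Let r := acos c.

Let c11 : -1 <= c <= 1.
Proof. by rewrite (ltW c1) andbT; apply: le_trans (ltW c0); rewrite lerN10. Qed.

Lemma truncated_cosine_bounds t : 0 < t -> t < acos c ->
  [/\ c < cos t, cos t <= 1, 0 < sin t & sin t <= 1].
Proof.
move=> t0 tr; have tpi : t < pi := lt_le_trans tr (acos_lepi c11).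
split; [|exact: cos_le1|by apply: sin_gt0_pi; rewrite t0|exact: sin_le1].
have tI : t \in `[0, pi] by rewrite in_itv/= !ltW.
have cI : acos c \in `[0, pi] by rewrite in_itv/= acos_ge0 ?acos_lepi.
by rewrite -[X in X < _](@acosK _ c) ?in_itv//= ltr_cos.
Qed.

(** This is [gfun] in the form of [gfunE], to be used with a = alpha - beta - 1 and b = 2 beta, both
    greater than -1. *)
Let g (t : R) := k * (cos t - c).
(** Each summand carries one of the two possible singularities, at 0 or at acos c, and is an exact
    derivative; [F] collects the primitives. *)
Let f (t : R) := sin t `^ b * cos t + g t `^ a * sin t.
Let F (t : R) := (b + 1)^-1 * sin t `^ (b + 1) - (k * (a + 1))^-1 * g t `^ (a + 1).

Let g_gt0 (t : R) : 0 < t -> t < r -> 0 < g t.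
Proof.
move=> t0 tr; have [ct _ _ _] := truncated_cosine_bounds _ t0 tr.
by rewrite mulr_gt0// subr_gt0.
Qed.

Let r_gt0 : 0 < r.
Proof. by apply: acos_gt0; rewrite c1 andbT; case/andP: c11. Qed.

Let integrable_f : mu.-integrable `]0, r[ (EFin \o f).
Proof.
have dg (t : R) : is_derive t 1 g (- (k * sin t)).
  have H : is_derive t 1 (fun x => cos x - c) (- sin t - 0) by exact: is_deriveB.
  have := @is_deriveZ _ _ _ _ k t 1 _ H.
  by move=> /is_derive_eq; apply; rewrite /GRing.scale/= subr0 mulrN.
have b10 : 0 < b + 1 by move: b1; lra.
have a10 : 0 < a + 1 by move: a1; lra.
have cg (t : R) : {for t, continuous g}.
  by apply: differentiable_continuous; apply/derivable1_diffP; case: (dg t).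
(* The offset 3 keeps r/(n+3) strictly below r/2, so even the first interval is nondegenerate. The
   bound on [F] uses sin t <= 1 and g t <= k. *)
apply: (@integrable_bounded_primitive _ f F _
    (fun n => r / n.+3%:R) (fun n => r - r / n.+3%:R)
    ((b + 1)^-1 + (k * (a + 1))^-1 * k `^ (a + 1))).
- move=> n; rewrite ltrBrDr -mulrDr gtr_pMr//.
  rewrite -mulr2n -[_ *+ 2]mulr_natl ltr_pdivrMr ?mul1r ?ltr_nat//.
- by move=> m n mn; rewrite ler_pM2l// lef_pV2 ?posrE// ler_nat.
- by move=> m n mn; rewrite lerB// ler_pM2l// lef_pV2 ?posrE// ler_nat.
- apply/seteqP; split => t /=.
    rewrite in_itv/= => /andP[t0 tr].
    have rt0 : 0 < r - t by rewrite subr_gt0.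
    (* Large enough for t to be at distance at least r/(n+3) from both 0 and r. *)
    pose n := Num.truncn (r / t + r / (r - t)).
    exists n => //=; rewrite in_itv/=.
    have : r / t + r / (r - t) < n.+1%:R by apply: truncnS_gt.
    have p1 : 0 < r / t by rewrite divr_gt0.
    have p2 : 0 < r / (r - t) by rewrite divr_gt0.
    have -> : n.+3%:R = n.+1%:R + 2 :> R by rewrite -natrD addn2.
    have := ler0n R n.+1; move: (n.+1%:R : R) => m m0 tn; have m20 : 0 < m + 2 by lra.
    apply/andP; split; [|rewrite lerBrDr addrC -lerBrDr].
      by rewrite ler_pdivrMr// -ler_pdivrMl// mulrC; lra.
    by rewrite ler_pdivrMr// -ler_pdivrMl// mulrC; lra.
  move=> [n _] /=; rewrite !in_itv/= => /andP[+ tr].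
  have rn : 0 < r / n.+3%:R by rewrite divr_gt0.
  by move=> /(lt_le_trans rn) -> /=; apply: le_lt_trans tr _; rewrite gtrBl.
- move=> t; rewrite /= in_itv/= => /andP[t0 tr].
  have [ct _ st _] := truncated_cosine_bounds _ t0 tr.
  by rewrite addr_ge0// mulr_ge0 ?powR_ge0 ?(ltW st)// ltW// (lt_trans c0).
- move=> t; rewrite /= in_itv/= => /andP[t0 tr].
  have [ct _ st _] := truncated_cosine_bounds _ t0 tr.
  apply: continuousD; apply: continuousM.
  + by apply: continuous_powR_comp => //; exact: continuous_sin.
  + exact: continuous_cos.
  + by apply: continuous_powR_comp => //; exact: g_gt0.
  + exact: continuous_sin.
- move=> t; rewrite /= in_itv/= => /andP[t0 tr].
  have [ct _ st _] := truncated_cosine_bounds _ t0 tr.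
  have H1 := @is_derive1_comp _ _ _ t _ _
    (is_derive1_powR (b + 1) st) (is_derive_sin t).
  have H2 := @is_derive1_comp _ _ _ t _ _
    (is_derive1_powR (a + 1) (g_gt0 _ t0 tr)) (dg t).
  have := is_deriveB (@is_deriveZ _ _ _ _ (b + 1)^-1 t 1 _ H1)
    (@is_deriveZ _ _ _ _ (k * (a + 1))^-1 t 1 _ H2).
  move=> /is_derive_eq; apply.
  rewrite /GRing.scale/= !addrK /f.
  by field; rewrite !gt_eqF.
- move=> t; rewrite /= in_itv/= => /andP[t0 tr].
  have [ct ct1 st st1] := truncated_cosine_bounds _ t0 tr.
  have ka0 : 0 <= (k * (a + 1))^-1 by rewrite invr_ge0 mulr_ge0// ltW.
  have b0 : 0 <= (b + 1)^-1 by rewrite invr_ge0 ltW.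
  apply: le_trans (ler_normB _ _) _.
  rewrite !ger0_norm ?mulr_ge0 ?powR_ge0// lerD//.
    rewrite ler_piMr// -[leRHS](_ : 1 `^ (b + 1) = 1); last by rewrite powR1.
    by rewrite ge0_ler_powR ?nnegrE// ltW.
  rewrite ler_wpM2l// ge0_ler_powR ?nnegrE ?(ltW k0) ?(ltW a10) ?(ltW (g_gt0 _ t0 tr))//.
  by rewrite ger_pMr//; move: c0; lra.
Qed.

(* Near 0 the integrand is comparable with [sin t `^ b * cos t], near [acos c]
   with [g t `^ a * sin t]; both have bounded primitives. *)
Lemma integrable_truncated_cosine :
  mu.-integrable `]0, acos c[ (EFin \o (fun t => (k * (cos t - c)) `^ a * sin t `^ b)).
Proof.
have c2 : 0 < (1 - c) / 2 by rewrite divr_gt0// subr_gt0.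
(* The domain is split at cos t = (1+c)/2, midway between c and 1. Where cos t is smaller, sin t >=
   sin^2 t >= q. *)
pose q := 1 - ((1 + c) / 2) ^+ 2.
have q0 : 0 < q.
  by rewrite /q subr_gt0 expr_lt1//; move: c0 c1; lra.
(* [A1] bounds g^a / cos t where k(1-c)/2 <= g <= k, using cos t > c; [A2] bounds sin^(b-1) where q
   <= sin t <= 1. *)
pose A1 := ((k * ((1 - c) / 2)) `^ a + k `^ a) / c.
pose A2 := q `^ (b - 1) + 1 `^ (b - 1).
have A10 : 0 <= A1 by rewrite divr_ge0 ?addr_ge0 ?powR_ge0 ?(ltW c0).
have A20 : 0 <= A2 by rewrite addr_ge0 ?powR_ge0.
have ms : measurable_fun (setT : set R) (@sin R).
  by apply: continuous_measurable_fun; exact: continuous_sin.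
have mc : measurable_fun (setT : set R) (@cos R).
  by apply: continuous_measurable_fun; exact: continuous_cos.
apply: le_integrable (integrableZl _ (A1 + A2) integrable_f) => //.
- apply/measurable_EFinP; apply: measurable_funTS; apply: measurable_funM.
    apply: (measurableT_comp (@measurable_powR R a)).
    by apply: measurable_funM => //; apply: measurable_funB.
  exact: (measurableT_comp (@measurable_powR R b)).
- move=> t; rewrite /= in_itv/= => /andP[t0 tr].
  have [ct ct1 st st1] := truncated_cosine_bounds _ t0 tr.
  have g0 := g_gt0 _ t0 tr; have cs0 := lt_trans c0 ct.
  have f10 : 0 <= sin t `^ b * cos t by rewrite mulr_ge0 ?powR_ge0// ltW.
  have f20 : 0 <= g t `^ a * sin t by rewrite mulr_ge0 ?powR_ge0// ltW.
  rewrite lee_fin !ger0_norm ?mulr_ge0 ?addr_ge0 ?powR_ge0//.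
  rewrite -/(g t) /f mulrDl !mulrDr.
  have [gt_|gt_] := leP (k * ((1 - c) / 2)) (g t).
    apply: (@le_trans _ _ (A1 * (sin t `^ b * cos t))); last first.
      by rewrite -addrA lerDl !addr_ge0// mulr_ge0.
    rewrite mulrCA mulrC ler_wpM2l ?powR_ge0//.
    rewrite /A1 mulrAC ler_pdivlMr//; apply: ler_pM => //; first exact: powR_ge0.
    - exact: ltW.
    - apply: powR_le_bounds => //; first by rewrite mulr_gt0.
      by rewrite /g ger_pMr//; move: c0; lra.
    - exact: ltW.
  apply: (@le_trans _ _ (A2 * (g t `^ a * sin t))); last first.
    by rewrite addrA lerDr !addr_ge0// mulr_ge0.
  rewrite mulrCA ler_wpM2l ?powR_ge0//.
  have -> : sin t `^ b = sin t `^ (b - 1) * sin t.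
    rewrite -[X in _ * X](powRr1 (ltW st)) -powRD; first by congr (_ `^ _); ring.
    by rewrite (negbT (gt_eqF st)) implybT.
  rewrite ler_wpM2r ?(ltW st)//; apply: powR_le_bounds => //.
  move: gt_; rewrite /g ltr_pM2l// => gt_.
  have : sin t ^+ 2 <= sin t by rewrite expr2 ger_pMr.
  apply: le_trans; rewrite sin2cos2 lerD2l lerN2 ler_pXn2r ?nnegrE//; lra.
Qed.

End truncated_cosine.

(** * Measurability of the kernels and the weight *)

Section measurability.
Context d (T : measurableType d) (R : realType).
Implicit Types f g : T -> R.

(** Writing 1/f as f (f^2)^(-1) reduces this to a real power of a nonnegative function; at f = 0
    both sides are 0 by convention. *)
Lemma measurable_funV f : measurable_fun setT f ->
  measurable_fun setT (fun t => (f t)^-1).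
Proof.
move=> mf; have -> : (fun t => (f t)^-1) = (fun t => f t * (f t ^+ 2) `^ (-1)).
  apply/funext => t; rewrite powR_inv1 ?sqr_ge0//.
  have [->|f0] := eqVneq (f t) 0; first by rewrite invr0 mul0r.
  by field.
apply: measurable_funM => //; apply: (measurableT_comp (@measurable_powR R (-1))).
exact: measurable_funX.
Qed.

Lemma measurable_fun_expR f : measurable_fun setT f ->
  measurable_fun setT (fun t => expR (f t)).
Proof. by move=> mf; apply: (measurableT_comp (@measurable_expR R)). Qed.

Lemma measurable_fun_powR f p : measurable_fun setT f ->
  measurable_fun setT (fun t => f t `^ p).
Proof. by move=> mf; apply: (measurableT_comp (@measurable_powR R p)). Qed.

Lemma measurable_fun_norm f : measurable_fun setT f ->
  measurable_fun setT (fun t => `|f t|).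
Proof. by move=> mf; apply: (measurableT_comp (@normr_measurable R setT)). Qed.

Lemma measurable_fun_sinh f : measurable_fun setT f ->
  measurable_fun setT (fun t => sinh (f t)).
Proof.
move=> mf; apply: measurable_funM => //; apply: measurable_funB.
  exact: measurable_fun_expR.
by apply: measurable_fun_expR; apply: measurable_funN.
Qed.

Lemma measurable_fun_cosh f : measurable_fun setT f ->
  measurable_fun setT (fun t => cosh (f t)).
Proof.
move=> mf; apply: measurable_funM => //; apply: measurable_funD.
  exact: measurable_fun_expR.
by apply: measurable_fun_expR; apply: measurable_funN.
Qed.

Lemma measurable_fun_sin f : measurable_fun setT f ->
  measurable_fun setT (fun t => sin (f t)).
Proof.
move=> mf; apply: (@measurableT_comp _ _ _ _ _ _ (@sin R)) => //.
by apply: continuous_measurable_fun; exact: continuous_sin.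
Qed.

Lemma measurable_fun_cos f : measurable_fun setT f ->
  measurable_fun setT (fun t => cos (f t)).
Proof.
move=> mf; apply: (@measurableT_comp _ _ _ _ _ _ (@cos R)) => //.
by apply: continuous_measurable_fun; exact: continuous_cos.
Qed.

Lemma measurable_fun_ppow f p : measurable_fun setT f ->
  measurable_fun setT (fun t => ppow (f t) p).
Proof.
move=> mf; apply: measurable_fun_ifT => //; last exact: measurable_fun_powR.
exact: measurable_fun_ltr.
Qed.

Lemma measurable_kernel_eq alpha x y (z : T -> R) : measurable_fun setT z ->
  measurable_fun setT (fun t => kernel_eq alpha x y (z t)).
Proof.
move=> mz; rewrite /kernel_eq.
do ?[exact: mz | exact: measurable_cst
   | apply: measurable_fun_sinh | apply: measurable_fun_powR
   | apply: measurable_funV | apply: measurable_fun_norm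
   | apply: measurable_fun_expR | apply: measurable_funM
   | apply: measurable_funB | apply: measurable_funD].
Qed.

Lemma measurable_weightA alpha beta (z : T -> R) : measurable_fun setT z ->
  measurable_fun setT (fun t => weightA alpha beta (z t)).
Proof.
move=> mz; apply: measurable_funM; apply: measurable_fun_powR.
  exact: measurable_fun_sinh.
exact: measurable_fun_cosh.
Qed.

End measurability.

(** Named as a function of z and chi so that joint measurability can be stated. *)
Definition kernel_gt_integrand {R : realType} (alpha beta x y z chi : R) : R :=
  ppow (gfun x y z chi) (alpha - beta - 1)
  * (1 - sigma x y z chi + sigma x z y chi + sigma z y x chi
     + rho alpha beta / (beta + 1 / 2)
       * (coth x * coth y * coth z) * sin chi ^+ 2)
  * sin chi `^ (2 * beta).

Lemma measurable_kernel_gt_integrand d (T : measurableType d) (R : realType)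
    (alpha beta x y : R) (z chi : T -> R) :
  measurable_fun setT z -> measurable_fun setT chi ->
  measurable_fun setT (fun t => kernel_gt_integrand alpha beta x y (z t) (chi t)).
Proof.
move=> mz mchi; rewrite /kernel_gt_integrand /gfun /sigma /coth.
do ?[exact: mz | exact: mchi | exact: measurable_cst
   | apply: measurable_fun_ppow | apply: measurable_fun_powR
   | apply: measurable_fun_sinh | apply: measurable_fun_cosh
   | apply: measurable_fun_sin | apply: measurable_fun_cos
   | apply: measurable_funV
   | apply: measurable_funM | apply: measurable_funX
   | apply: measurable_funB | apply: measurable_funD ].
Qed.

(** * Sign of the kernel for beta < alpha *)

Section kernel_gt_sign.
Context {R : realType}.
Local Notation mu := (@lebesgue_measure R).
Variables (alpha beta x y z : R).
Hypotheses (ab : beta < alpha) (b0 : - (1 / 2) < beta) (x0 : 0 < x) (y0 : 0 < y).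
Hypotheses (xyz : `|x - y| < `|z|) (zxy : `|z| < x + y).

Let z0 : z != 0.
Proof. by rewrite -normr_gt0; exact: le_lt_trans xyz. Qed.

Let s := sinh x * sinh y * sinh z.

Let s0 : s != 0.
Proof. by rewrite /s !(sinh_eq0, mulf_eq0) !negb_or z0 !gt_eqF. Qed.

Let K := rho alpha beta / (beta + 1 / 2).

Let K0 : 0 <= K.
Proof. by rewrite /K /rho divr_ge0//; move: ab b0; lra. Qed.

Let N := bracket_numer K x y z.
Let c := gfun_root x y z.
Let k := 2 * cosh x * cosh y * cosh z.
(** The factor [s] has the sign of z and turns the integrand into a nonnegative function whatever
    that sign is. *)
Let P chi := kernel_gt_integrand alpha beta x y z chi * s.

Let k0 : 0 < k.
Proof. by rewrite !(cosh_gt0, mulr_gt0). Qed.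

Let c0 : 0 < c := gfun_root_gt0 x y z.
Let c1 : c < 1 := gfun_root_lt1 _ _ _ x0 y0 xyz zxy.

Let N_gt0 C : c <= C -> C <= 1 -> 0 < N C.
Proof. by move=> cC C1; apply: bracket_numer_gt0. Qed.

Let PE chi : P chi =
  ppow (k * (cos chi - c)) (alpha - beta - 1) * sin chi `^ (2 * beta) * N (cos chi).
Proof.
rewrite /P /kernel_gt_integrand gfunE bracketE ?(gt_eqF x0, gt_eqF y0)// -/s -/K.
by rewrite -/N -/k -/c; field.
Qed.

Let P_ge0 chi : 0 <= chi -> chi <= pi -> 0 <= P chi.
Proof.
move=> chi0 chipi; rewrite PE /ppow; case: ifPn => [g0|_]; last by rewrite !mul0r.
rewrite !mulr_ge0 ?powR_ge0// ltW// N_gt0 ?cos_le1//.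
by move: g0; rewrite pmulr_rgt0// subr_gt0 => /ltW.
Qed.

Let c11 : -1 <= c <= 1.
Proof. by rewrite (ltW c1) andbT; apply: le_trans (ltW c0); rewrite lerN10. Qed.

Let P_inside chi : 0 < chi -> chi < acos c ->
  P chi = (k * (cos chi - c)) `^ (alpha - beta - 1) * sin chi `^ (2 * beta) * N (cos chi).
Proof.
move=> chi0 chic; have [ct _ _ _] := truncated_cosine_bounds _ c0 c1 _ chi0 chic.
by rewrite PE /ppow mulr_gt0// subr_gt0.
Qed.

Let P_outside chi : acos c <= chi -> chi <= pi -> P chi = 0.
Proof.
move=> cchi chipi; rewrite PE /ppow ifF ?mul0r//; apply/negbTE.
rewrite -leNgt pmulr_rle0// subr_le0 -[leRHS](@acosK _ c) ?in_itv//=.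
have ac : acos c \in `[0, pi] by rewrite in_itv/= acos_ge0 ?acos_lepi.
have tc : chi \in `[0, pi] by rewrite in_itv/= chipi andbT (le_trans (acos_ge0 c11)).
by rewrite leNgt ltr_cos// -leNgt.
Qed.

Let P_gt0 chi : 0 < chi -> chi < acos c -> 0 < P chi.
Proof.
move=> chi0 chic; have [ct ct1 st _] := truncated_cosine_bounds _ c0 c1 _ chi0 chic.
rewrite P_inside//; apply: mulr_gt0; last by rewrite N_gt0// ltW.
by rewrite mulr_gt0 ?powR_gt0// mulr_gt0// subr_gt0.
Qed.

Let mP : measurable_fun (setT : set R) P.
Proof.
by apply: measurable_funM => //; apply: measurable_kernel_gt_integrand.
Qed.

(** Lets [P] be dominated by a multiple of the truncated cosine integrand. *)
Let N_bounded : exists B, forall C, `|C| <= 1 -> `|N C| <= B.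
Proof.
pose p0 := N 0; pose p2 := K * (cosh x * cosh y * cosh z).
pose p1 := sinh z * cosh z - sinh y * cosh y - sinh x * cosh x.
exists (`|p0| + `|p1| + `|p2|) => C C1.
have -> : N C = p0 + p1 * C - p2 * C ^+ 2.
  by rewrite /p0 /p1 /p2 /N /bracket_numer; ring.
apply: le_trans (ler_normB _ _) _; rewrite lerD//.
  by apply: le_trans (ler_normD _ _) _; rewrite lerD// normrM ler_piMr.
by rewrite normrM ler_piMr// normrX exprn_ile1.
Qed.

Let integrable_P : mu.-integrable `[0, pi] (EFin \o P).
Proof.
have [B hB] := N_bounded.
have i1 : mu.-integrable `]0, acos c[ (EFin \o P).
  have i0 := integrable_truncated_cosine k c (alpha - beta - 1) (2 * beta) k0 c0 c1.
  apply: le_integrable (integrableZl _ B (i0 _ _)) => //.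
  - by apply/measurable_EFinP; exact: measurable_funTS.
  - move=> chi; rewrite /= in_itv/= => /andP[chi0 chic].
    rewrite lee_fin P_inside// normrM mulrC [leRHS]normrM ler_wpM2r//.
    by apply: le_trans (hB _ (cos_max _)) _; exact: ler_norm.
  - by move: ab; lra.
  - by move: b0; lra.
have aP : acos c <= pi := acos_lepi c11.
(* Off the negligible point 0, where [P] need not vanish, [P] on [0, pi] is the extension by zero of
   its restriction to ]0, acos c[. *)
apply/(@negligible_integrable _ _ _ mu _ [set 0]) => //.
- by apply/measurable_EFinP; exact: measurable_funTS.
- exact: lebesgue_measure_set1.
apply: (@eq_integrable _ _ _ mu _ _ ((EFin \o P) \_ `]0, acos c[)) => //.
- by apply: measurableD => //; exact: measurable_set1.
- move=> t /set_mem[/=]; rewrite in_itv/= => /andP[t0 tpi] tn0.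
  rewrite patchE; case: ifPn => // /negP tn.
  rewrite P_outside// leNgt; apply/negP => tc; apply: tn; apply/mem_set => /=.
  by rewrite in_itv/= tc andbT lt_neqAle t0 andbT eq_sym; apply/eqP.
- apply: (@integrableS _ _ _ mu setT) => //; last first.
    exact: (iffLR (@integrable_mkcond _ _ _ mu _ _ _) i1).
  by apply: measurableD => //; exact: measurable_set1.
Qed.

(** The quotient form treats both signs of z at once: p contains the integral of [P] divided by sinh
    x sinh y, and 1/sinh z is what remains of 1/s. *)
Lemma kernel_gt_sign : exists2 p, 0 < p & kernel_gt alpha beta x y z = p / sinh z.
Proof.
have muE : (0 < mu (`]0%R, acos c[%classic : set R))%E.
  have ac : 0 < acos c by apply: acos_gt0; rewrite c1 andbT; case/andP: c11.
  by rewrite lebesgue_measure_itv/= lte_fin ac oppr0 adde0 lte_fin.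
have I0 : 0 < \int[mu]_(t in `[0, pi]) P t.
  apply: (@Rintegral_gt0 R _ _ mu _ _ `]0, acos c[%classic) => //.
  - move=> t /=; rewrite !in_itv/= => /andP[/ltW-> /ltW ta]/=.
    by rewrite (le_trans ta)// acos_lepi.
  - by move=> t /=; rewrite in_itv/= => /andP[]; exact: P_ge0.
  - by move=> t /=; rewrite in_itv/= => /andP[]; exact: P_gt0.
have M0 : 0 < constM alpha beta.
  rewrite /constM gt_eqF// divr_gt0 ?mulr_gt0 ?Gamma_gt0 ?sqrtr_gt0 ?pi_gt0//;
    by move: ab b0; lra.
exists (constM alpha beta * `|s| `^ (- (2 * alpha))
    * ((\int[mu]_(t in `[0, pi]) P t) / (sinh x * sinh y))).
  apply: mulr_gt0; first by rewrite mulr_gt0 ?powR_gt0 ?normr_gt0.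
  by apply: divr_gt0 => //; apply: mulr_gt0; rewrite sinh_gt0.
have -> : kernel_gt alpha beta x y z = constM alpha beta
    * `|s| `^ (- (2 * alpha)) * \int[mu]_(t in `[0, pi]) (P t * s^-1).
  rewrite /kernel_gt; congr (_ * _).
  by apply: eq_Rintegral => t _; rewrite /P mulfK.
rewrite RintegralZr//; move: (\int[mu]_(t in `[0, pi]) P t) => I.
by rewrite -[RHS]mulrA -[(I / _) / _]mulrA -invfM.
Qed.

End kernel_gt_sign.

(** * The case alpha = beta, and the kernel in general *)

Lemma kernel_eq_sign (R : realType) (alpha x y z : R) : - (1 / 2) < alpha ->
  0 < x -> 0 < y -> `|x - y| < `|z| -> `|z| < x + y ->
  exists2 p, 0 < p & kernel_eq alpha x y z = p / sinh z.
Proof.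
move=> a0 x0 y0 xyz /ltr_normlP[zxy1 zxy2].
have z0 : z != 0 by rewrite -normr_gt0; exact: le_lt_trans xyz.
(* Both factors have the sign of z because |x - y| < |z|; hence the kernel takes its sign from
   sinh(2z) = 2 sinh z cosh z in the denominator. *)
pose q := sinh (- x + y + z) * sinh (x - y + z).
have q0 : 0 < q.
  case: (ltgtP z 0) z0 xyz => // zs _.
    rewrite (ltr0_norm zs) => /ltr_normlP[h1 h2].
    by rewrite /q nmulr_rgt0 sinh_lt0; lra.
  rewrite (gtr0_norm zs) => /ltr_normlP[h1 h2].
  by apply: mulr_gt0; rewrite sinh_gt0; lra.
have p1 : 0 < sinh (x + y + z) by rewrite sinh_gt0; lra.
have p2 : 0 < sinh (x + y - z) by rewrite sinh_gt0; lra.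
have M0 : 0 < constM alpha alpha.
  rewrite /constM eqxx; apply: divr_gt0; first by apply: Gamma_gt0; lra.
  by rewrite mulr_gt0 ?sqrtr_gt0 ?pi_gt0//; apply: Gamma_gt0; lra.
have s0 (t : R) : t != 0 -> sinh (2 * t) != 0.
  by move=> t0; rewrite sinh_eq0 mulf_neq0.
pose p := 2 `^ (4 * alpha + 2) * constM alpha alpha * expR (x + y - z)
  * ((sinh (x + y + z) * sinh (- x + y + z) * sinh (x - y + z)
        * sinh (x + y - z)) `^ (alpha - 1 / 2)
     / `|sinh (2 * x) * sinh (2 * y) * sinh (2 * z)| `^ (2 * alpha)).
have p0 : 0 < p.
  apply: mulr_gt0.
    by rewrite mulr_gt0 ?expR_gt0// mulr_gt0// powR_gt0.
  apply: divr_gt0; apply: powR_gt0.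
    by rewrite -(mulrA (sinh (x + y + z))) -/q; do 2!apply: mulr_gt0 => //.
  by rewrite normr_gt0 mulf_neq0 ?s0// mulf_neq0// s0// gt_eqF.
exists (p * (sinh (x + y + z) * q
    / (sinh (2 * x) * sinh (2 * y) * (2 * cosh z)))).
  apply: mulr_gt0 => //; apply: divr_gt0; first exact: mulr_gt0.
  apply: mulr_gt0; last by rewrite mulr_gt0 ?cosh_gt0.
  by apply: mulr_gt0; rewrite sinh_gt0 mulr_gt0.
rewrite /kernel_eq -/p /q (sinh2 z); clearbody p.
have z1 : sinh z != 0 by rewrite sinh_eq0.
by field; rewrite z1 cosh_neq0 !s0// gt_eqF.
Qed.

Lemma kernelK_sign (R : realType) (alpha beta x y z : R) :
  beta <= alpha -> - (1 / 2) < beta -> 0 < x -> 0 < y ->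
  `|x - y| < `|z| -> `|z| < x + y ->
  exists2 p, 0 < p & kernelK alpha beta x y z = p / sinh z.
Proof.
move=> ab b0 x0 y0 xyz zxy.
have z0 : z != 0 by rewrite -normr_gt0; exact: le_lt_trans xyz.
rewrite /kernelK (gtr0_norm x0) (gtr0_norm y0) xyz zxy z0 (gt_eqF x0) (gt_eqF y0)/=.
have [_|ne] := eqVneq alpha beta; first by apply: kernel_eq_sign => //; lra.
by apply: kernel_gt_sign => //; rewrite lt_neqAle eq_sym ne.
Qed.

(** For arbitrary z the integrand has no fixed sign, so Tonelli's theorem is applied separately to
    the positive and negative parts of its extension by zero to the plane. *)
Lemma measurable_kernel_gt (R : realType) (alpha beta x y : R) :
  measurable_fun (setT : set R) (kernel_gt alpha beta x y).
Proof.
pose G (p : R * R) : \bar R :=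
  (kernel_gt_integrand alpha beta x y p.1 p.2 * \1_(`[0, pi]%classic : set R) p.2)%:E.
have mG : measurable_fun setT G.
  apply/measurable_EFinP; apply: measurable_funM.
    exact: measurable_kernel_gt_integrand.
  by apply: (measurableT_comp (@measurable_indic _ _ _ setT _ _)).
have GE (z : R) : (\int[lebesgue_measure]_(chi in `[0%R, pi])
      (kernel_gt_integrand alpha beta x y z chi)%:E
    = fubini_F lebesgue_measure G^\+ z - fubini_F lebesgue_measure G^\- z)%E.
  rewrite integral_mkcond [X in integral _ _ X](_ : _ = fun t => G (z, t)).
    rewrite integralE; congr (_ - _)%E; apply: eq_integral => t _.
      by rewrite !funeposE.
    by rewrite !funenegE.
  apply/funext => t; rewrite patchE /G indicE/=.
  by case: ifPn => _; rewrite ?mulr1 ?mulr0.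
have mI : measurable_fun (setT : set R)
    (fun z : R => \int[lebesgue_measure]_(chi in `[0, pi])
      kernel_gt_integrand alpha beta x y z chi)%R.
  rewrite /Rintegral; apply: measurableT_comp => //.
  rewrite (funext GE); apply: emeasurable_funB;
    apply: measurable_fun_fubini_tonelli_F => //.
  - exact: measurable_funepos.
  - exact: measurable_funeneg.
apply: measurable_funM => //; apply: measurable_funM => //.
apply: measurable_fun_powR; apply: measurable_fun_norm.
by apply: measurable_funM => //; apply: measurable_fun_sinh.
Qed.

(** * Both sign statements, and failure of positivity of the measure *)

Theorem mainTheorem5 (R : realType) (alpha beta : R)
    (hab : beta <= alpha) (hb : - (1 / 2) < beta)
    (x y : R) (hx : 0 < x) (hy : 0 < y) :
  [/\ forall z : R, - x - y < z -> z < - `|x - y| ->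
        kernelK alpha beta x y z < 0,
      forall z : R, `|x - y| < z -> z < x + y ->
        0 < kernelK alpha beta x y z &
      ~ (muK alpha beta x y).-positive_set [set: R] ].
Proof.
have neg (z : R) : - x - y < z -> z < - `|x - y| ->
    [/\ z < 0, `|x - y| < `|z| & `|z| < x + y].
  move=> z1 z2; have z0 : z < 0.
    by apply: lt_le_trans z2 _; rewrite oppr_le0.
  by split=> //; rewrite (ltr0_norm z0); [rewrite ltrNr | rewrite ltrNl opprD].
have Kneg (z : R) : - x - y < z -> z < - `|x - y| -> kernelK alpha beta x y z < 0.
  move=> z1 z2; have [z0 h1 h2] := neg z z1 z2.
  have [p p0 ->] := kernelK_sign _ _ _ _ _ _ hab hb hx hy h1 h2.
  by rewrite pmulr_rlt0// invr_lt0 sinh_lt0.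
split=> // [z z1 z2|].
  have z0 : 0 < z by apply: le_lt_trans z1.
  have h1 : `|x - y| < `|z| by rewrite (gtr0_norm z0).
  have h2 : `|z| < x + y by rewrite (gtr0_norm z0).
  have [p p0 ->] := kernelK_sign _ _ _ _ _ _ hab hb hx hy h1 h2.
  by rewrite divr_gt0// sinh_gt0.
pose E : set R := `]- x - y, - `|x - y|[%classic.
(* The negated density is positive on [E], so nonnegative integration applies, even if the integral
   is infinite. *)
pose f z := - (kernelK alpha beta x y z * weightA alpha beta `|z|).
have f_gt0 z : E z -> 0 < f z.
  rewrite /E/= in_itv/= => /andP[z1 z2]; rewrite /f oppr_gt0.
  have [z0 _ _] := neg z z1 z2.
  rewrite nmulr_rlt0 ?Kneg// /weightA.
  by rewrite mulr_gt0 ?powR_gt0 ?cosh_gt0// sinh_gt0 normr_gt0 lt_eqF.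
have mf : measurable_fun E f.
  apply: measurable_funN; apply: measurable_funM; last first.
    apply: measurable_funTS; apply: measurable_weightA.
    exact: measurable_fun_norm.
  (* On [E] the support condition holds, so [kernelK] agrees with a formula measurable on the whole
     line. *)
  have e : {in E, (if alpha == beta then kernel_eq alpha x y
      else kernel_gt alpha beta x y) =1 kernelK alpha beta x y}.
    move=> z /set_mem; rewrite /E/= in_itv/= => /andP[z1 z2].
    have [z0 h1 h2] := neg z z1 z2.
    rewrite /kernelK (gtr0_norm hx) (gtr0_norm hy) h1 h2 (lt_eqF z0).
    by rewrite (gt_eqF hx) (gt_eqF hy)/=; case: ifP.
  apply: eq_measurable_fun e _; apply: measurable_funTS.
  by case: ifP => _; [exact: measurable_kernel_eq|exact: measurable_kernel_gt].
(* Positivity of the whole line would give [E] nonnegative measure. *)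
move=> [_ /(_ E)]; rewrite /muK => /(_ (measurable_itv _) (@subsetT _ _)).
have muE : (0 < (@lebesgue_measure R) E)%E.
  rewrite lebesgue_measure_itv/= lte_fin.
  have xy : - x - y < - `|x - y|.
    by rewrite -opprD ltrN2 ltr_norml; apply/andP; split; lra.
  by rewrite xy -EFinD lte_fin subr_gt0.
have -> : (\int[lebesgue_measure]_(z in E)
    (kernelK alpha beta x y z * weightA alpha beta `|z|)%:E =
  - \int[lebesgue_measure]_(z in E) (f z)%:E)%E.
  rewrite -integral_ge0N; last by move=> z Ez; rewrite lee_fin ltW// f_gt0.
  by apply: eq_integral => z _; rewrite -EFinN opprK.
rewrite oppe_ge0 => I0.
suff : (0 < \int[lebesgue_measure]_(z in E) (f z)%:E)%E by rewrite ltNge I0.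
apply: (@integral_gt0 _ _ _ lebesgue_measure _ E E) => //.
- exact: measurable_itv.
- exact: measurable_itv.
- exact: (iffRL (measurable_EFinP _ _) mf).
- by move=> z Ez; rewrite lee_fin ltW// f_gt0.
Qed.
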